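(* Let $\mathbb{F}$ be a finite field of characteristic $q>2$ and $f(\bar x)=\prod_{i=1}^n(1-x_i)-2$. Then every roABP-$\mathrm{IPS}_{\mathrm{LIN}'}$ refutation of $f(\bar x\circ\bar y)=0$, in a variable order in which every $x_i$ precedes every $y_j$, has size $2^{\Omega(n)}$.
   Context: $\bar x\circ\bar y=(x_1y_1,\dots,x_ny_n)$, so $f(\bar x\circ\bar y)\in\mathbb{F}[x_1,\dots,x_n,y_1,\dots,y_n]$. An roABP in variable order $v_{\pi(1)}<\dots<v_{\pi(N)}$ is a layered DAG with layers $V_0,\dots,V_N$, unique source in $V_0$ and sink in $V_N$, edges from $V_{\ell-1}$ to $V_\ell$ labelled by univariate polynomials in $v_{\pi(\ell)}$; it computes the sum over source–sink paths of products of labels; width $r=\max|V_\ell|$, size $N\cdot r\cdot D\cdot N$ with $D$ the maximal label degree. A roABP-$\mathrm{IPS}_{\mathrm{LIN}'}$ refutation of $h(\bar v)=0$ ($\bar v$ the $N$ instance variables) is a polynomial $C(\bar v,t,s_1,\dots,s_N)$ computed by an roABP with $C(\bar v,0,\bar0)=0$, $C(\bar v,h,v_1^2-v_1,\dots,v_N^2-v_N)=1$, and $C$ of degree $\le1$ in $t$; the variable order refers to the order it induces on the instance variables; size is the roABP's size. *)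

(* Defs.v *)
From Stdlib Require Import Reals.
From HB Require Import structures.
From mathcomp Require Import all_boot all_fingroup all_algebra.
From mathcomp Require Import mpoly.

Set Implicit Arguments.
Unset Strict Implicit.
Unset Printing Implicit Defensive.

Import GRing.Theory.

(* The key R is taken by ring_scope. *)
Delimit Scope R_scope with Re.

Local Open Scope ring_scope.

Record roabp (F : nzRingType) (N : nat) := ROABP {
  ro_vertex : finType;
  ro_layer : ro_vertex -> 'I_N.+1;
  ro_source : ro_vertex;
  ro_sink : ro_vertex;
  ro_edge : rel ro_vertex;
  (* only the values of ro_label on edges are meaningful *)
  ro_label : ro_vertex -> ro_vertex -> {poly F};
  (* ro_order l is the variable read between layers l and l.+1 *)
  ro_order : 'S_N;
  ro_layer_source : forall v, (ro_layer v == ord0) = (v == ro_source);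
  ro_layer_sink : forall v, (ro_layer v == ord_max) = (v == ro_sink);
  ro_layer_edge : forall u v, ro_edge u v ->
    ro_layer v = (ro_layer u).+1 :> nat
}.

Section Roabp.
Variables (F : comNzRingType) (N : nat).

Definition univ_in (j : 'I_N) (p : {poly F}) : {mpoly F[N]} :=
  (map_poly (@mpolyC N F) p).['X_j].

(* A path is given by its vertices after the source; layering forces every
   source-sink path to have exactly N edges. *)
Definition roabp_poly (A : roabp F N) : {mpoly F[N]} :=
  let s := ro_source A in
  \sum_(p : N.-tuple (ro_vertex A)
         | path (@ro_edge F N A) s p && (last s p == ro_sink A))
    \prod_(l < N)
      univ_in (ro_order A l) (ro_label (nth s (s :: p) l) (nth s p l)).

Definition roabp_width (A : roabp F N) : nat :=
  \max_(l < N.+1) #|[set v : ro_vertex A | ro_layer v == l]|.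

Definition roabp_degree (A : roabp F N) : nat :=
  \max_(e : ro_vertex A * ro_vertex A | ro_edge e.1 e.2)
    (size (ro_label e.1 e.2)).-1.

Definition roabp_size (A : roabp F N) : nat :=
  (N * roabp_width A * roabp_degree A * N)%N.

Definition precedes (A : roabp F N) (i j : 'I_N) : bool :=
  (((ro_order A)^-1)%g i < ((ro_order A)^-1)%g j)%N.

End Roabp.

(* The variables of a certificate C(v, t, s) for N instance variables. *)
Definition var_v (N : nat) (i : 'I_N) : 'I_(N + (1 + N)) := lshift (1 + N) i.
Definition var_t (N : nat) : 'I_(N + (1 + N)) := rshift N (lshift N ord0).
Definition var_s (N : nat) (i : 'I_N) : 'I_(N + (1 + N)) :=
  rshift N (rshift 1 i).

Section IPS.
Variables (F : comNzRingType) (N : nat).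

(* C(v, a, b_1, ..., b_N) *)
Definition ips_subst (C : {mpoly F[N + (1 + N)]}) (a : {mpoly F[N]})
    (b : 'I_N -> {mpoly F[N]}) : {mpoly F[N]} :=
  C \mPo [tuple match split k with
                | inl i => 'X_i
                | inr k' => match split k' with inl _ => a | inr i => b i end
                end | k < N + (1 + N)].

Definition ips_lin' (h : {mpoly F[N]}) (C : {mpoly F[N + (1 + N)]}) : Prop :=
  [/\ ips_subst C 0 (fun=> 0) = 0,
      ips_subst C h (fun i => 'X_i ^+ 2 - 'X_i) = 1
    & forall m, m \in msupp C -> (m (var_t N) <= 1)%N].

Definition roabp_ips_lin' (h : {mpoly F[N]}) (A : roabp F (N + (1 + N))) :
    Prop :=
  ips_lin' h (roabp_poly A).

End IPS.

Section Instance.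
Variables (F : comNzRingType) (n : nat).

(* Instance variables: the x_i come first, then the y_i. *)
Definition var_x (i : 'I_n) : 'I_(n + n) := lshift n i.
Definition var_y (i : 'I_n) : 'I_(n + n) := rshift n i.

Definition compose_xy (f : {mpoly F[n]}) : {mpoly F[n + n]} :=
  f \mPo [tuple 'X_(var_x i) * 'X_(var_y i) | i < n].

Definition f_inst : {mpoly F[n]} := \prod_(i < n) (1 - 'X_i) - 2%:R.

Definition x_before_y (A : roabp F ((n + n) + (1 + (n + n)))) : Prop :=
  forall i j : 'I_n, precedes A (var_v (var_x i)) (var_v (var_y j)).

End Instance.

(* Main.v *)
Require Import Defs.
From Stdlib Require Import Reals.
From HB Require Import structures.
From mathcomp Require Import all_boot all_fingroup all_algebra.
From mathcomp Require Import mpoly.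

(* On Boolean points the certificate, at t = 1 and s = 0, is forced to equal
   1 / f(x o y): it is affine in t with zero constant term. Since f(x o y) is -1
   or -2 according to whether the supports A of x and B of y are disjoint,
   [A and B disjoint] = - 2 / f(x o y) - 1. The disjointness matrix has full
   rank 2^n (after complementing B it is the zeta matrix of the subset order).
   Cutting the roABP at a layer that separates the x_i from the y_j factors the
   matrix 1 / f through the vertices of that layer, so the width is at least
   2^n - 1. *)

Set Implicit Arguments.
Unset Strict Implicit.
Unset Printing Implicit Defensive.

Import GRing.Theory.
Local Open Scope ring_scope.

(** * Rank of the disjointness matrix *)

(** The zeta matrix of the subset order is unitriangular: by induction on the cardinality of [B],
    all terms at proper subsets vanish and only [c B] is left. *)
Lemma subset_sum_eq0 (F : zmodType) (T : finType) (c : {set T} -> F) :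
  (forall B : {set T}, \sum_(A : {set T} | A \subset B) c A = 0) ->
  forall B, c B = 0.
Proof.
move=> c0 B; move: {2}#|B| (leqnn #|B|) => k.
elim: k B => [|k IHk] B leBk; have := c0 B; rewrite (bigD1 B) //= big1 ?addr0 //;
    move=> A /andP[sAB neAB].
- by move: leBk sAB neAB; rewrite leqn0 cards_eq0 => /eqP->; rewrite subset0 => ->.
- apply: IHk; rewrite -ltnS; apply: leq_trans leBk.
  by apply: proper_card; rewrite properEneq neAB.
Qed.

Lemma disjointness_rank (F : fieldType) (T Z : finType)
    (a b : {set T} -> Z -> F) :
  (forall A B : {set T}, [disjoint A & B]%:R = \sum_z a A z * b B z) ->
  (2 ^ #|T| <= #|Z|)%N.
Proof.
move=> dE; rewrite -cardsT -card_powerset powersetT cardsT.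
pose I := {set T} : finType.
pose MA := \matrix_(i < #|I|, j < #|Z|) a (enum_val i) (enum_val j).
pose MB := \matrix_(j < #|Z|, i < #|I|) b (enum_val i) (enum_val j).
suff /eqP <- : row_free (MA *m MB) by apply: mulmx_max_rank.
apply: inj_row_free => v vD0.
have c0 : forall B : {set T}, v 0 (enum_rank B) = 0.
  (* Column [~: B] is used because [A] is disjoint from [~: B] exactly when [A] is a subset of
     [B]. *)
  apply: subset_sum_eq0 => B; move/rowP/(_ (enum_rank (~: B))): vD0.
  rewrite !mxE => vD0; rewrite -[RHS]vD0 big_mkcond (reindex_onto enum_val enum_rank) /=;
    last by move=> i _; rewrite enum_rankK.
  apply: eq_big => [i | i _]; first by rewrite enum_valK eqxx.
  rewrite enum_valK mxE -{1}[B]setCK -disjoints_subset.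
  have -> : \sum_j MA i j * MB j (enum_rank (~: B)) =
      [disjoint (enum_val i : {set T}) & ~: B]%:R.
    rewrite dE [RHS](reindex_onto enum_val enum_rank) /=;
      last by move=> j _; rewrite enum_rankK.
    apply: eq_big => [j|j _]; first by rewrite enum_valK eqxx.
    by rewrite !mxE !enum_rankK.
  by case: disjoint; rewrite ?mulr1 ?mulr0.
by apply/rowP=> i; rewrite mxE -[i]enum_valK c0.
Qed.

(** * Weighted walks in a layered graph *)

(** This is the entry at [u], [v] of the product of the transfer matrices [w 0], ..., [w (k - 1)].
    In this form, cutting a program at a layer is associativity of the matrix product. *)
Fixpoint walk_sum (F : pzSemiRingType) (V : finType) (k : nat)
    (w : nat -> V -> V -> F) (u v : V) : F :=
  if k is k'.+1 then
    \sum_z w 0%N u z * walk_sum k' (fun l => w l.+1) z v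
  else (u == v)%:R.

Lemma eq_walk_sum (F : pzSemiRingType) (V : finType) k
    (w w' : nat -> V -> V -> F) u v :
  (forall l, (l < k)%N -> w l =2 w' l) -> walk_sum k w u v = walk_sum k w' u v.
Proof.
elim: k w w' u => //= k IHk w w' u eq_w; apply: eq_bigr => z _.
by rewrite eq_w // (IHk _ (fun l => w' l.+1)) // => l ltlk; apply: eq_w.
Qed.

Lemma walk_sumD (F : pzSemiRingType) (V : finType) j k
    (w : nat -> V -> V -> F) u v :
  walk_sum (j + k) w u v =
  \sum_z walk_sum j w u z * walk_sum k (fun l => w (j + l)%N) z v.
Proof.
elim: j w u => /= [|j IHj] w u.
  rewrite (bigD1 u) //= eqxx mul1r big1 ?addr0 // => z /negPf.
  by rewrite eq_sym => ->; rewrite mul0r.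
under eq_bigr do rewrite IHj mulr_sumr.
rewrite exchange_big; apply: eq_bigr => z _.
by rewrite mulr_suml; apply: eq_bigr => y _; rewrite mulrA.
Qed.

Lemma walk_sum_layer (F : pzSemiRingType) (V : finType) k
    (w : nat -> V -> V -> F) (h : V -> nat) u v :
  (forall l x y, w l x y != 0 -> h y = (h x).+1) ->
  walk_sum k w u v != 0 -> h v = (h u + k)%N.
Proof.
elim: k w u => /= [|k IHk] w u hw.
  by case: (eqVneq u v) => [->|_]; rewrite ?eqxx ?addn0.
apply: contra_neq_eq => /eqP neq_h; rewrite big1 // => z _.
have [->|/hw hz] := eqVneq (w 0%N u z) 0; first by rewrite mul0r.
have [->|/IHk hv] := eqVneq (walk_sum k (fun l => w l.+1) z v) 0.
  by rewrite mulr0.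
by case: neq_h; rewrite hv ?hz ?addSnnS // => l x y; apply: hw.
Qed.

Lemma walk_sum_tuple (F : comPzSemiRingType) (V : finType) (e : rel V) (d : V) k
    (w : nat -> V -> V -> F) u v :
  \sum_(p : k.-tuple V | path e u p && (last u p == v))
     \prod_(l < k) w l (nth d (u :: p) l) (nth d p l) =
  walk_sum k (fun l x y => if e x y then w l x y else 0) u v.
Proof.
elim: k w u => [|k IHk] w u.
  rewrite /= big_mkcond (big_pred1 [tuple]) /=; last by move=> p; apply/esym/eqP/tuple0.
  by rewrite big_ord0; case: eqP.
rewrite (reindex (fun x : V * k.-tuple V => [tuple of x.1 :: x.2])) /=; last first.
  exists (fun p : k.+1.-tuple V => (thead p, [tuple of behead p])).
    by case=> x p _ /=; rewrite theadE; congr (_, _); apply: val_inj.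
  by move=> p _; rewrite [RHS]tuple_eta; apply: val_inj.
under [RHS]eq_bigr => z _ do rewrite -(IHk (fun l => w l.+1)) mulr_sumr.
rewrite pair_big_dep big_mkcond [RHS]big_mkcond.
apply: eq_bigr => -[z p] _ /=; rewrite big_ord_recl /=.
by case: (e u z) => //=; rewrite mul0r if_same.
Qed.

(** * Evaluating and cutting an roABP *)

Lemma univ_in_meval (F : comNzRingType) N (j : 'I_N) (p : {poly F})
    (pt : 'I_N -> F) :
  (univ_in j p).@[pt] = p.[pt j].
Proof.
rewrite /univ_in -horner_map /= -map_poly_comp mevalXU.
by rewrite map_poly_id // => c _; rewrite /= mevalC.
Qed.

(* The value 0 for l >= N is a dummy: only steps l < N are ever taken. *)
Definition roabp_weight (F : comNzRingType) N (A : roabp F N) (pt : 'I_N -> F)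
    (l : nat) (x y : ro_vertex A) : F :=
  if ro_edge x y then
    if insub l is Some i then (ro_label x y).[pt (ro_order A i)] else 0
  else 0.

Lemma roabp_weight_layer (F : comNzRingType) N (A : roabp F N) pt l
    (x y : ro_vertex A) :
  roabp_weight pt l x y != 0 -> ro_layer y = (ro_layer x).+1 :> nat.
Proof.
by rewrite /roabp_weight; case: ifP => [/ro_layer_edge|]; rewrite ?eqxx.
Qed.

Lemma roabp_meval (F : comNzRingType) N (A : roabp F N) (pt : 'I_N -> F) :
  (roabp_poly A).@[pt] =
  walk_sum N (roabp_weight pt) (ro_source A) (ro_sink A).
Proof.
rewrite /roabp_weight -(walk_sum_tuple _ (ro_source A)) raddf_sum.
apply: eq_bigr => p _; rewrite /= rmorph_prod; apply: eq_bigr => l _.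
by rewrite /= univ_in_meval valK.
Qed.

(** Each source-sink path meets layer [l] exactly once: [a] sums over the prefixes, [b] over the
    suffixes, and each reads only the variables on its own side of the cut. *)
Lemma roabp_cut (F : comNzRingType) N (A : roabp F N) (l : 'I_N.+1) :
  exists a b : ('I_N -> F) -> ro_vertex A -> F,
  [/\ forall pt, (roabp_poly A).@[pt] =
        \sum_(z | ro_layer z == l) a pt z * b pt z,
      forall pt pt',
        (forall i : 'I_N, (i < l)%N ->
           pt (ro_order A i) = pt' (ro_order A i)) -> a pt =1 a pt'
    & forall pt pt',
        (forall i : 'I_N, (l <= i)%N ->
           pt (ro_order A i) = pt' (ro_order A i)) -> b pt =1 b pt'].
Proof.
exists (fun pt z => walk_sum l (roabp_weight pt) (ro_source A) z).
exists (fun pt z =>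
  walk_sum (N - l) (fun k => roabp_weight pt (l + k)) z (ro_sink A)).
split=> [pt | pt pt' eq_pt z | pt pt' eq_pt z].
- rewrite roabp_meval.
  have := walk_sumD l (N - l) (roabp_weight pt) (ro_source A) (ro_sink A).
  rewrite (subnKC (ltn_ord l : (l <= N)%N)) => ->.
  (* The product formula sums over all vertices [z]; those outside layer [l] contribute 0, since a
     nonzero walk of length [l] from the source ends in layer [l]. *)
  rewrite [RHS]big_mkcond; apply: eq_bigr => z _; case: eqP => // neq_l.
  have [->|/walk_sum_layer] :=
    eqVneq (walk_sum l (roabp_weight pt) (ro_source A) z) 0.
    by rewrite mul0r.
  move=> /(_ (fun v => ro_layer v)) lz; case: neq_l; apply: ord_inj.
  have /eqP src0 : ro_layer (ro_source A) == ord0 by rewrite ro_layer_source.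
  rewrite lz; first by rewrite src0.
  by move=> k x y; apply: roabp_weight_layer.
- apply: eq_walk_sum => k ltkl x y; rewrite /roabp_weight; case: ifP => // _.
  by case: insubP => // i _ ik; rewrite eq_pt // ik.
- apply: eq_walk_sum => k _ x y; rewrite /roabp_weight; case: ifP => // _.
  by case: insubP => // i _ ik; rewrite eq_pt // ik leq_addr.
Qed.

Lemma roabp_degree0 (F : comNzRingType) N (A : roabp F N) (pt pt' : 'I_N -> F) :
  roabp_degree A = 0%N -> (roabp_poly A).@[pt] = (roabp_poly A).@[pt'].
Proof.
move=> deg0; rewrite !roabp_meval; apply: eq_walk_sum => l _ x y.
rewrite /roabp_weight; case: ifP => // xy; case: insubP => // i _ _.
(* The truncated predecessor of the size is 0 for the zero polynomial and for nonzero constants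
   alike, so every edge label is constant. *)
have /size1_polyC-> : (size (ro_label x y) <= 1)%N; last by rewrite !hornerC.
have /(_ xy) := leq_bigmax_cond (F := fun e => (size (ro_label e.1 e.2)).-1)
  (P := fun e : ro_vertex A * ro_vertex A => ro_edge e.1 e.2) (x, y).
by rewrite -/(roabp_degree A) deg0 leqn0 /=; case: size => [|[]].
Qed.

(** * Certificates at Boolean points *)

Definition ips_point (F : comNzRingType) N (v : 'I_N -> F) (a : F)
    (b : 'I_N -> F) (k : 'I_(N + (1 + N))) : F :=
  match split k with
  | inl i => v i
  | inr k' => match split k' with inl _ => a | inr i => b i end
  end.

Lemma ips_subst_meval (F : comNzRingType) N (C : {mpoly F[N + (1 + N)]})
    (a : {mpoly F[N]}) (b : 'I_N -> {mpoly F[N]}) (v : 'I_N -> F) :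
  (ips_subst C a b).@[v] = C.@[ips_point v a.@[v] (fun i => (b i).@[v])].
Proof.
rewrite comp_mpoly_meval; apply: meval_eq => k; rewrite tnth_mktuple /ips_point.
by case: (split k) => [i|k']; [rewrite mevalXU | case: (split k')].
Qed.

(** Linear interpolation between 0 and 1, checked monomial by monomial: the exponent of [t] is 0 or
    1, and both [1] and [a] satisfy the identity. *)
Lemma meval_affine (F : comNzRingType) N (C : {mpoly F[N]}) (t : 'I_N)
    (pt : F -> 'I_N -> F) (a : F) :
    (forall m, m \in msupp C -> (m t <= 1)%N) ->
    (forall c, pt c t = c) ->
    (forall c i, i != t -> pt c i = pt 0 i) ->
  C.@[pt a] = (1 - a) * C.@[pt 0] + a * C.@[pt 1].
Proof.
move=> degC pt_t pt_nt; rewrite !mevalE !mulr_sumr -big_split /=.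
rewrite big_seq [RHS]big_seq; apply: eq_bigr => m /degC mt.
have mE c : \prod_i pt c i ^+ m i = c ^+ m t * \prod_(i | i != t) pt 0 i ^+ m i.
  by rewrite (bigD1 t) //= pt_t; congr (_ * _); apply: eq_bigr => i /pt_nt->.
rewrite !mE !mulrA -mulrDl; congr (_ * _).
case: (m t) mt => [|[|]] // _; rewrite ?expr0 ?expr1 ?mulr1 ?mulr0 ?add0r.
  by rewrite -mulrDl subrK mul1r.
by rewrite mulrC.
Qed.

(** At a Boolean [v] every [s] argument vanishes. The certificate is then affine in [t] and 0 at
    [t = 0], so its value at [t = h(v)], which is 1, is [h(v)] times its value at [t = 1]. *)
Lemma ips_lin'_boolean (F : comNzRingType) N (h : {mpoly F[N]})
    (C : {mpoly F[N + (1 + N)]}) (v : 'I_N -> F) :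
    ips_lin' h C -> (forall i, v i ^+ 2 = v i) ->
  h.@[v] * C.@[ips_point v 1 (fun=> 0)] = 1.
Proof.
case=> C0 C1 degC v_bool.
have := congr1 (meval v) C1; rewrite meval1 ips_subst_meval => Ch.
rewrite -[RHS]Ch.
have -> : C.@[ips_point v h.@[v] (fun i => ('X_i ^+ 2 - 'X_i).@[v])] =
          C.@[ips_point v h.@[v] (fun=> 0)].
  apply: meval_eq => k; rewrite /ips_point; case: split => // k'.
  by case: split => // i; rewrite mevalB rmorphXn /= mevalXU v_bool subrr.
have C00 : C.@[ips_point v 0 (fun=> 0)] = 0.
  have := congr1 (meval v) C0; rewrite ips_subst_meval !meval0 => C0v.
  rewrite -[RHS]C0v; apply: meval_eq => k; rewrite /ips_point.
  by case: split => // k'; case: split => // i; rewrite meval0.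
pose pt c := ips_point v c (fun=> 0).
rewrite -/(pt _) -/(pt h.@[v]) (meval_affine h.@[v] degC (pt := pt)).
- by rewrite C00 mulr0 add0r.
- by move=> c; rewrite /pt /ips_point /var_t (unsplitK (inr _)) (unsplitK (inl _)).
- move=> c i; rewrite /pt /ips_point; case: splitP => // j ij.
  case: splitP => // z jz /eqP[]; apply: ord_inj.
  by rewrite ij jz (ord1 z).
Qed.

(** * Width and size lower bounds for the instance *)

Definition bool_point (F : comNzRingType) n (A B : {set 'I_n})
    (k : 'I_(n + n)) : F :=
  match split k with inl i => (i \in A)%:R | inr i => (i \in B)%:R end.

Lemma compose_xy_inst_meval (F : comNzRingType) n (A B : {set 'I_n}) :
  (compose_xy (f_inst F n)).@[bool_point F A B] = [disjoint A & B]%:R - 2%:R.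
Proof.
rewrite comp_mpoly_meval mevalB rmorph_prod /= rmorph_nat; congr (_ - _).
under eq_bigr => i _.
  rewrite mevalB meval1 mevalXU tnth_mktuple mevalM !mevalXU /bool_point.
  rewrite /var_x /var_y (unsplitK (inl i)) (unsplitK (inr i)) -natrM mulnb.
  over.
rewrite /=; case: (boolP [disjoint A & B]) => [dAB|].
  rewrite big1 // => i _; case: andP => [[iA iB]|]; last by rewrite subr0.
  by have := disjointFr dAB iA; rewrite iB.
rewrite -setI_eq0 => /set0Pn[i /setIP[iA iB]].
by rewrite (bigD1 i) //= iA iB subrr mul0r.
Qed.

Lemma roabp_width_lb (F : fieldType) n
    (A : roabp F ((n + n) + (1 + (n + n)))) :
  roabp_ips_lin' (compose_xy (f_inst F n)) A -> x_before_y A ->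
  (2 ^ n <= (roabp_width A).+1)%N.
Proof.
move=> refA xy.
pose pos k := ((ro_order A)^-1)%g k.
pose pt (S T : {set 'I_n}) := ips_point (bool_point F S T) 1 (fun=> 0).
(* The cut is placed right after the last [x] variable is read. The variables [t] and [s] may fall
   on either side, as [pt] fixes them to 1 and 0. *)
have lP : (\max_(i < n) (pos (var_v (var_x i))).+1 <= n + n + (1 + (n + n)))%N.
  by apply/bigmax_leqP => i _; apply: ltn_ord.
pose l : 'I_(n + n + (1 + (n + n))).+1 := Ordinal (lP : (_ < _.+1)%N).
have [a [b [cutA aP bP]]] := roabp_cut A l.
pose g S T := (roabp_poly A).@[pt S T].
have l_y k : (l <= pos (var_v (var_y k)))%N.
  by apply/bigmax_leqP => i _; apply: xy.
have x_l k : (pos (var_v (var_x k)) < l)%N.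
  exact: (leq_bigmax (F := fun i => (pos (var_v (var_x i))).+1) k).
(* The prefix reads no [y] and the suffix reads no [x], so the set belonging to the other side can
   be replaced by [set0]. *)
have gE S T : g S T =
    \sum_(z | ro_layer z == l) a (pt S set0) z * b (pt set0 T) z.
  rewrite /g cutA; apply: eq_bigr => z _; congr (_ * _).
    apply: aP => i lti; rewrite /pt /ips_point.
    case: splitP => // j ij; rewrite /bool_point; case: splitP => // k jk.
    have iy : ro_order A i = var_v (var_y k) by apply: ord_inj; rewrite ij /= jk.
    by have := l_y k; rewrite -iy /pos permK leqNgt lti.
  apply: bP => i lti; rewrite /pt /ips_point.
  case: splitP => // j ij; rewrite /bool_point; case: splitP => // k jk.
  have ix : ro_order A i = var_v (var_x k) by apply: ord_inj; rewrite ij /= jk.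
  by have := x_l k; rewrite -ix /pos permK ltnNge lti.
(* With [d] the disjointness bit, [(d - 2) * g S T = 1]: for [d = 1] this gives [g S T = -1], for
   [d = 0] it gives [2 * g S T = -1]. *)
have dE (S T : {set 'I_n}) : [disjoint S & T]%:R = - (2%:R * g S T) - 1.
  have vb i : bool_point F S T i ^+ 2 = bool_point F S T i.
    by rewrite /bool_point; case: split => j; case: (_ \in _);
      rewrite ?expr1n ?expr0n.
  have := ips_lin'_boolean refA vb; rewrite compose_xy_inst_meval -/(g S T).
  case: disjoint => /=; last by rewrite sub0r mulNr => ->; rewrite subrr.
  have -> : 1%:R - 2%:R = -1 :> F by rewrite -[2%:R]/(1 + 1) opprD addNKr.
  by rewrite mulN1r => gN1; rewrite mulrC -mulNr gN1 mul1r -[2%:R]/(1 + 1) addrK.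
(* The extra index [None] carries the constant term [-1] of the affine relation; it accounts for the
   [.+1] on the width. *)
pose Z := {z : ro_vertex A | ro_layer z == l}.
pose a' S (z : option Z) := if z is Some z then - 2%:R * a (pt S set0) (val z) else -1.
pose b' T (z : option Z) := if z is Some z then b (pt set0 T) (val z) else 1.
have := @disjointness_rank F 'I_n (option Z) a' b'.
rewrite card_ord card_option card_sig => ub.
apply: leq_trans (ub _) _ => [S T|].
  rewrite dE gE (bigD1 None) //= mulN1r addrC; congr (_ + _).
  rewrite [RHS](reindex_omap Some id) /=; last by case.
  under [RHS]eq_bigl do rewrite eqxx.
  rewrite -mulNr mulr_sumr (big_sub [pred z | ro_layer z == l]).
  by apply: eq_bigr => z _; rewrite mulrA.
rewrite ltnS; apply: leq_trans (leq_bigmax l).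
by rewrite cardsE.
Qed.

(** A program of degree 0 takes the same value everywhere, whereas a certificate takes both values 0
    and 1. Positivity matters because the degree is a factor of the size. *)
Lemma roabp_degree_gt0 (F : comNzRingType) N (h : {mpoly F[N]})
    (A : roabp F (N + (1 + N))) :
  roabp_ips_lin' h A -> (0 < roabp_degree A)%N.
Proof.
case=> C0 C1 _; rewrite lt0n; apply/eqP => deg0.
have := congr1 (meval (fun=> 0)) C1; rewrite ips_subst_meval meval1.
set p := (X in _.@[X]); move=> E1.
have := congr1 (meval (fun=> 0)) C0; rewrite ips_subst_meval !meval0.
by rewrite (roabp_degree0 _ p deg0) E1 => /eqP; rewrite oner_eq0.
Qed.

Lemma roabp_size_lb (F : fieldType) n
    (A : roabp F ((n + n) + (1 + (n + n)))) :
  (0 < n)%N -> roabp_ips_lin' (compose_xy (f_inst F n)) A -> x_before_y A ->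
  (2 ^ n <= roabp_size A)%N.
Proof.
move=> n_gt0 refA xy; have wlb := roabp_width_lb refA xy.
have w_gt0 : (0 < roabp_width A)%N.
  by rewrite -ltnS; apply: leq_trans wlb; rewrite -{1}(expn0 2) ltn_exp2l.
apply: leq_trans wlb _; rewrite /roabp_size.
have deg_gt0 := roabp_degree_gt0 refA.
set N := (_ + _)%N; have N_gt1 : (1 < N)%N.
  by rewrite /N addnA addn1 ltnS !addn_gt0 n_gt0.
(* The successor is absorbed by one factor [N]: for a positive width [w],
   [w + 1 <= 2 * w <= N * w]. *)
apply: (@leq_trans (N * roabp_width A)).
  apply: (@leq_trans (2 * roabp_width A)); last by rewrite leq_mul2r N_gt1 orbT.
  by rewrite mul2n -addnn -addn1 leq_add2l.
by rewrite -(mulnA (N * _)) leq_pmulr // muln_gt0 deg_gt0 ltnW.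
Qed.

Unset Implicit Arguments.

Local Close Scope ring_scope.

Theorem theorem5p3 (F : finFieldType) (q : nat)
    (charF : q \in [pchar F]%R) (q_gt2 : 2 < q) :
  exists (c : R) (n0 : nat), (0 < c)%Re /\
    forall n : nat, n0 <= n ->
    forall A : roabp F ((n + n) + (1 + (n + n))),
      roabp_ips_lin' (compose_xy (f_inst F n)) A ->
      x_before_y A ->
      (Rpower 2 (c * INR n) <= INR (roabp_size A))%Re.
Proof.
(* The bound [2 ^ n] holds with no loss in the exponent, hence [c = 1]; the threshold [n0 = 1]
   supplies the positivity of [n] used in the size bound. *)
exists 1%Re, 1; split=> [|n n_gt0 A refA xy]; first exact: Rlt_0_1.
have /leP/le_INR := roabp_size_lb n_gt0 refA xy; apply: Rle_trans.
rewrite Rmult_1_l Rpower_pow; last exact: Rlt_0_2.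
have <- : INR (2 ^ n) = pow 2 n; last exact: Rle_refl.
by elim: n {n_gt0 A refA xy} => //= n <-; rewrite expnS mult_INR.
Qed.
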